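(* Let $d\ge 2$ be a fixed integer, let $\delta\in[0,1)$ be a constant, let $s=s_n=n^{-(d-1)+\delta+o(1)}$, and let $(\mathcal H,A)\sim\mathbb P$ be sampled from the noisy projection model with parameters $0\le q=q_n\le p=p_n\le 1$ defined in the context. (1) Suppose that $p=o(1)$. Then for any estimator $\widehat{\mathcal H}=\widehat{\mathcal H}(A)$ (a function of $A$ taking values in sets of $d$-element subsets of $[n]$), $$\mathbb E_{(\mathcal H,A)\sim\mathbb P}\Big[\big|\widehat{\mathcal H}(A)\,\triangle\,\mathcal H\big|\Big]\ge(1-o(1))\cdot s\tbinom nd\qquad (n\to\infty),$$ and this holds even when $q=0$. (2) Suppose that $\delta\le\frac{d-1}{d+1}$ and $q=n^{-1+\beta+o(1)}$ for a constant $\beta>\frac{2\delta}{d(d-1)}+\frac{d-2}{d}$. Then for any estimator $\widehat{\mathcal H}=\widehat{\mathcal H}(A)$, $$\mathbb E_{(\mathcal H,A)\sim\mathbb P}\Big[\big|\widehat{\mathcal H}(A)\,\triangle\,\mathcal H\big|\Big]\ge(1-o(1))\cdot s\tbinom nd\qquad (n\to\infty),$$ and this holds even when $p=1$.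
   Context: Model. $\operatorname U_{n,d}$ is the collection of all $d$-element subsets of $[n]=\{1,\dots,n\}$. The random $d$-uniform hypergraph $\mathcal H$ on $[n]$ (identified with its set of hyperedges) includes each $\Psi\in \operatorname U_{n,d}$ independently with probability $s\in[0,1]$. The projection $\mathcal P(\mathcal H)$ is the graph on $[n]$ in which an unordered pair $(i,j)$, $i\ne j$, is an edge if and only if some $\Psi\in\mathcal H$ contains both $i$ and $j$. Under $\mathbb P$: first sample $\mathcal H$; then, conditionally on $\mathcal H$, the random graph $A$ on $[n]$ includes, independently over pairs, each pair $(i,j)\in\mathcal P(\mathcal H)$ with probability $p$ and each pair $(i,j)\notin\mathcal P(\mathcal H)$ with probability $q$. $\triangle$ denotes symmetric difference of sets of hyperedges. All asymptotics are as $n\to\infty$ with $d,\delta$ (and $\beta$) fixed. *)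

(* Defs.v *)
From HB Require Import structures.
From mathcomp Require Import all_boot all_order all_algebra.
From mathcomp Require Import boolp classical_sets reals topology normedtype.
From mathcomp Require Import sequences exp.
Set Implicit Arguments.
Unset Strict Implicit.
Unset Printing Implicit Defensive.
Import Order.TTheory GRing.Theory Num.Theory.
Import numFieldNormedType.Exports.
Local Open Scope ring_scope.

Definition dsubset (n d : nat) := {S : {set 'I_n} | #|S| == d}.

Definition hypergraph (n d : nat) := {set dsubset n d}.

(* A simple graph is its set of edges, i.e. a 2-uniform hypergraph. *)
Definition graph (n : nat) := hypergraph n 2.

Definition projection (n d : nat) (H : hypergraph n d) : graph n :=
  [set e : dsubset n 2 | [exists Psi in H, val e \subset val Psi]]%SET.

Definition symdiff (T : finType) (A B : {set T}) : {set T} :=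
  ((A :\: B) :|: (B :\: A))%SET.

(* Probability mass at B of the random subset of T that contains each x
   independently with probability r x. *)
Definition bernoulli_subset (R : realType) (T : finType) (r : T -> R)
    (B : {set T}) : R :=
  \prod_(x : T) (if x \in B then r x else 1 - r x).

Lemma bernoulli_subset_sum1 (R : realType) (T : finType) (r : T -> R) :
  \sum_(B : {set T}) bernoulli_subset r B = 1.
Proof.
by rewrite -bigA_distr big1 // => x _ /=; rewrite addrC subrK.
Qed.

Definition hypergraph_pmf (R : realType) (n d : nat) (s : R)
    (H : hypergraph n d) : R :=
  bernoulli_subset (fun _ : dsubset n d => s) H.

Definition graph_pmf (R : realType) (n d : nat) (p q : R)
    (H : hypergraph n d) (A : graph n) : R :=
  bernoulli_subset
    (fun e : dsubset n 2 => if e \in projection H then p else q) A.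

Definition model_expectation (R : realType) (n d : nat) (s p q : R)
    (f : hypergraph n d -> graph n -> R) : R :=
  \sum_(H : hypergraph n d) \sum_(A : graph n)
    hypergraph_pmf s H * graph_pmf p q H A * f H A.

Definition risk (R : realType) (n d : nat) (s p q : R)
    (Hhat : graph n -> hypergraph n d) : R :=
  model_expectation s p q
    (fun (H : hypergraph n d) (A : graph n) => #|symdiff (Hhat A) H|%:R).

(* u n = n ^ (a + o(1)) as n tends to infinity. *)
Definition power_order (R : realType) (u : nat -> R) (a : R) : Prop :=
  exists eps : nat -> R,
    (eps @ \oo --> (0 : R))%classic /\
    (\forall n \near \oo, u n = n%:R `^ (a + eps n))%classic.

(* The error term depends on n only: it is uniform over all estimators. *)
Definition risk_asymptotically_trivial (R : realType) (d : nat)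
    (s p q : nat -> R) : Prop :=
  exists err : nat -> R,
    (err @ \oo --> (0 : R))%classic /\
    (\forall n \near \oo, forall Hhat : graph n -> hypergraph n d,
       (1 - err n) * (s n * 'C(n, d)%:R) <= risk (s n) (p n) (q n) Hhat)%classic.

(* Main.v *)
(* By linearity the risk is a sum over d-sets Psi of the error of testing
   whether Psi lies in H. Conditionally on H minus Psi, the two laws of A differ
   only on the pairs inside Psi, and it suffices that the posterior odds of Psi
   be at most 1 with conditional probability 1 - o(1) given Psi in H.
   (1) Given Psi in H, with probability (1 - p)^C(d,2) no pair inside Psi is an
   edge of A, and then the likelihood ratio is at most 1.
   (2) The likelihood ratio never exceeds q^-C(d,2), and the hypothesis on beta
   says exactly that s * q^-C(d,2) is a negative power of n. *)
Require Import Defs.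
From HB Require Import structures.
From mathcomp Require Import all_boot all_order all_algebra.
From mathcomp Require Import boolp classical_sets reals topology normedtype.
From mathcomp Require Import sequences exp.
From mathcomp Require Import ring lra.
Set Implicit Arguments.
Unset Strict Implicit.
Unset Printing Implicit Defensive.
Import Order.TTheory GRing.Theory Num.Theory.
Import numFieldNormedType.Exports.
Local Open Scope ring_scope.

(** * Random subsets with independent elements *)

Lemma bernoulli_subset_ge0 (R : realType) (T : finType) (r : T -> R)
    (B : {set T}) :
  (forall x, 0 <= r x <= 1) -> 0 <= bernoulli_subset r B.
Proof.
move=> r01; apply: prodr_ge0 => x _; have /andP[r0 r1] := r01 x.
by case: ifP => _ //; rewrite subr_ge0.
Qed.

(** Lowering [r] to 0 on [E] inside the product of [r x + (1 - r x)] kills exactly the sets that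
    meet [E]; each factor outside [E] stays 1. *)
Lemma bernoulli_subset_avoid (R : realType) (T : finType) (r : T -> R)
    (E : {set T}) :
  \sum_(B : {set T} | [disjoint B & E]) bernoulli_subset r B =
  \prod_(x in E) (1 - r x).
Proof.
pose r' x := if x \in E then 0 else r x.
transitivity (\prod_x (r' x + (1 - r x))); last first.
  rewrite [RHS]big_mkcond; apply: eq_bigr => x _; rewrite /r'.
  by case: ifP => _; rewrite ?add0r // addrC subrK.
rewrite bigA_distr [LHS]big_mkcond; apply: eq_bigr => B _.
case: ifPn => [dBE | /pred0Pn[x /andP[/= xB xE]]].
  apply: eq_bigr => x _; case: ifP => // xB.
  by rewrite /r' (disjointFr dBE xB).
by rewrite (bigD1 x) //= xB /r' xE mul0r.
Qed.

(** The law of [B] with [x] forgotten: the value does not depend on whether [x] is in [B], so sums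
    of it run over the sets without [x]. *)
Definition bernoulli_subset_off (R : realType) (T : finType) (r : T -> R)
    (x : T) (B : {set T}) : R :=
  \prod_(y | y != x) (if y \in B then r y else 1 - r y).

Lemma bernoulli_subset_off_ge0 (R : realType) (T : finType) (r : T -> R)
    (x : T) (B : {set T}) :
  (forall y, 0 <= r y <= 1) -> 0 <= bernoulli_subset_off r x B.
Proof.
move=> r01; apply: prodr_ge0 => y _; have /andP[r0 r1] := r01 y.
by case: ifP => _ //; rewrite subr_ge0.
Qed.

(** Conditions on everything but [x], by pairing each [B] without [x] with [x |: B]. This isolates
    the test for a single hyperedge. *)
Lemma bernoulli_subset_resample (R : realType) (T : finType) (r : T -> R)
    (x : T) (f : {set T} -> R) :
  \sum_(B : {set T}) bernoulli_subset r B * f B =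
  \sum_(B : {set T} | x \notin B) bernoulli_subset_off r x B *
    (r x * f (x |: B)%SET + (1 - r x) * f B).
Proof.
rewrite (bigID (fun B : {set T} => x \notin B)) /= addrC.
rewrite (reindex_onto (fun B => x |: B)%SET (fun B => B :\ x)%SET) /=;
  last first.
  by move=> B; rewrite negbK => xB; rewrite finset.setD1K.
rewrite (eq_bigl (fun B : {set T} => x \notin B)); last first.
  move=> B; rewrite negbK finset.setU11 /=.
  apply/eqP/idP => [<- | xB]; first by rewrite !inE eqxx.
  by rewrite finset.setU1K.
rewrite -big_split /=; apply: eq_bigr => B xB.
rewrite /bernoulli_subset (bigD1 x) //= finset.setU11.
rewrite [X in _ + X * _](bigD1 x) //= (negbTE xB).
rewrite (eq_bigr (fun y => if y \in B then r y else 1 - r y)); last first.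
  by move=> y /negbTE yx; rewrite !inE yx.
by rewrite -/(bernoulli_subset_off r x B); ring.
Qed.

Lemma bernoulli_subset_off_sum1 (R : realType) (T : finType) (r : T -> R)
    (x : T) :
  \sum_(B : {set T} | x \notin B) bernoulli_subset_off r x B = 1.
Proof.
rewrite -(bernoulli_subset_sum1 r).
transitivity (\sum_(B : {set T}) bernoulli_subset r B * 1); last first.
  by apply: eq_bigr => B _; rewrite mulr1.
rewrite (bernoulli_subset_resample r x (fun=> 1)).
by apply: eq_bigr => B _; ring.
Qed.

(** * Effect of one added hyperedge on the law of the graph *)

Definition pairs_in (n d : nat) (Psi : dsubset n d) : graph n :=
  [set e : dsubset n 2 | val e \subset val Psi]%SET.

Lemma card_pairs_in (n d : nat) (Psi : dsubset n d) :
  #|pairs_in Psi| = 'C(d, 2).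
Proof.
rewrite -[in RHS](eqP (valP Psi)) -cards_draws -(card_imset _ val_inj).
apply: eq_card => S; rewrite inE; apply/imsetP/andP => [[e + ->]|[SPsi S2]].
  by rewrite inE => ePsi; split=> //; exact: (valP e).
by exists (exist _ S S2); rewrite ?inE.
Qed.

Lemma card_dsubset (n d : nat) : #|{: dsubset n d}| = 'C(n, d).
Proof.
rewrite card_sig -[in RHS](card_ord n) -card_draws.
by apply: eq_card => S; rewrite !inE.
Qed.

Lemma projection_setU1 (n d : nat) (Psi : dsubset n d) (H : hypergraph n d) :
  projection (Psi |: H)%SET = (pairs_in Psi :|: projection H)%SET.
Proof.
apply/finset.setP => e; rewrite !inE; apply/existsP/orP.
  move=> [Phi /andP[]]; rewrite !inE => /orP[/eqP -> | PhiH] ePhi; first by left.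
  by right; apply/existsP; exists Phi; rewrite PhiH.
move=> [ePsi | /existsP[Phi /andP[PhiH ePhi]]].
  by exists Psi; rewrite setU11.
by exists Phi; rewrite !inE PhiH orbT.
Qed.

Lemma graph_pmf_ge0 (R : realType) (n d : nat) (p q : R) (H : hypergraph n d)
    (A : graph n) :
  0 <= q -> q <= p -> p <= 1 -> 0 <= graph_pmf p q H A.
Proof.
move=> q0 qp p1; apply: bernoulli_subset_ge0 => e.
by case: ifP => _; apply/andP; split; lra.
Qed.

Lemma graph_pmf_sum_avoid (R : realType) (n d : nat) (p q : R)
    (Psi : dsubset n d) (H : hypergraph n d) :
  \sum_(A : graph n | [disjoint A & pairs_in Psi])
    graph_pmf p q (Psi |: H)%SET A = (1 - p) ^+ 'C(d, 2).
Proof.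
rewrite bernoulli_subset_avoid -(card_pairs_in Psi) -prodr_const.
by apply: eq_bigr => e ePsi; rewrite projection_setU1 finset.in_setU ePsi.
Qed.

(** Every pair inside [Psi] is a non-edge of [A], and [1 - p <= 1 - q]; the factors at all other
    pairs agree. *)
Lemma graph_pmf_setU1_avoid (R : realType) (n d : nat) (p q : R)
    (Psi : dsubset n d) (H : hypergraph n d) (A : graph n) :
  0 <= q -> q <= p -> p <= 1 -> [disjoint A & pairs_in Psi] ->
  graph_pmf p q (Psi |: H)%SET A <= graph_pmf p q H A.
Proof.
move=> q0 qp p1 dA; apply: ler_prod => e _.
rewrite projection_setU1 finset.in_setU.
have [ePsi|_] /= := boolP (e \in pairs_in Psi).
  rewrite (disjointFl dA ePsi).
  by case: ifP => _; apply/andP; split; lra.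
by rewrite lexx andbT; do 2![case: ifP => _]; lra.
Qed.

(** Each pair inside [Psi] absorbs one factor [q]: [q * p <= q] for an edge, [q * (1 - p) <= 1 - p]
    for a non-edge. *)
Lemma graph_pmf_setU1_le (R : realType) (n d : nat) (p q : R)
    (Psi : dsubset n d) (H : hypergraph n d) (A : graph n) :
  0 <= q -> q <= p -> p <= 1 ->
  q ^+ 'C(d, 2) * graph_pmf p q (Psi |: H)%SET A <= graph_pmf p q H A.
Proof.
move=> q0 qp p1; rewrite -(card_pairs_in Psi) -prodr_const big_mkcond /=.
rewrite -big_split /=; apply: ler_prod => e _.
rewrite projection_setU1 finset.in_setU.
have [ePsi|_] /= := boolP (e \in pairs_in Psi); last first.
  by rewrite mul1r lexx andbT; do 2![case: ifP => _]; lra.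
by do 2![case: ifP => _]; apply/andP; split; nra.
Qed.

(** * Lower bound on the risk *)

Lemma riskE (R : realType) (n d : nat) (s p q : R)
    (Hhat : graph n -> hypergraph n d) :
  risk s p q Hhat = \sum_(Psi : dsubset n d) \sum_(H : hypergraph n d)
    hypergraph_pmf s H * \sum_(A : graph n)
      graph_pmf p q H A * ((Psi \in Hhat A) (+) (Psi \in H))%:R.
Proof.
rewrite /risk /model_expectation [RHS]exchange_big /=; apply: eq_bigr => H _.
rewrite -mulr_sumr exchange_big mulr_sumr /=; apply: eq_bigr => A _.
rewrite -mulr_sumr mulrA -sum1_card natr_sum big_mkcond /=; congr (_ * _).
apply: eq_bigr => Psi _.
by rewrite !inE; do 2![case: (_ \in _)] => /=; rewrite ?mulr0 ?mulr1.
Qed.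

(* Given [H \ Psi], the optimal test between [Psi] absent and [Psi] present
   errs with probability [\sum_A min (s * P1 A) ((1 - s) * P0 A)], and the
   minimum is its first argument on [N Psi]. *)
Lemma risk_ge (R : realType) (n d : nat) (s p q c : R)
    (N : dsubset n d -> pred (graph n)) (Hhat : graph n -> hypergraph n d) :
  0 <= s <= 1 -> 0 <= q -> q <= p -> p <= 1 ->
  (forall Psi (H : hypergraph n d),
     c <= \sum_(A : graph n | N Psi A) graph_pmf p q (Psi |: H)%SET A) ->
  (forall Psi (H : hypergraph n d) A, N Psi A ->
     s * graph_pmf p q (Psi |: H)%SET A <= (1 - s) * graph_pmf p q H A) ->
  c * (s * 'C(n, d)%:R) <= risk s p q Hhat.
Proof.
move=> /andP[s0 s1] q0 qp p1 cN likelihood.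
rewrite riskE mulrA -card_dsubset mulr_natr -sumr_const.
apply: ler_sum => Psi _.
rewrite (bernoulli_subset_resample _ Psi).
(* Averaging the constant [c * s] over the law of [H] without [Psi] reduces the bound to each fixed
   [H]. *)
rewrite -[c * s]mul1r.
rewrite -[X in X * (c * s)](bernoulli_subset_off_sum1 (fun=> s) Psi) mulr_suml.
apply: ler_sum => H PsiH; apply: ler_wpM2l.
  by apply: bernoulli_subset_off_ge0 => _; rewrite s0.
apply: (@le_trans _ _ (s * \sum_(A | N Psi A) graph_pmf p q (Psi |: H)%SET A)).
  by rewrite mulrC ler_wpM2l.
rewrite !mulr_sumr -big_split /= big_mkcond /=; apply: ler_sum => A _.
have g0 := graph_pmf_ge0 H A q0 qp p1.
have g1 := graph_pmf_ge0 (Psi |: H)%SET A q0 qp p1.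
have likelihoodA := likelihood Psi H A.
rewrite setU11 (negbTE PsiH).
have sg0 : 0 <= (1 - s) * graph_pmf p q H A by rewrite mulr_ge0 ?subr_ge0.
have sg1 : 0 <= s * graph_pmf p q (Psi |: H)%SET A by rewrite mulr_ge0.
(* Accepting [Psi] costs the absent term, which dominates on [N Psi]; rejecting it costs the present
   term itself. *)
case: (Psi \in Hhat A); rewrite /= ?mulr0 ?mulr1 ?addr0 ?add0r.
  by case: ifP => // NA; exact: likelihoodA.
by case: ifP.
Qed.

Lemma bernoulli_inequality (R : realType) (x : R) (m : nat) :
  0 <= x <= 1 -> 1 - m%:R * x <= (1 - x) ^+ m.
Proof.
move=> /andP[x0 x1]; elim: m => [|m IH]; first by rewrite mul0r subr0 expr0.
have m0 : 0 <= m%:R :> R := ler0n _ _.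
rewrite exprS -natr1.
apply: (@le_trans _ _ ((1 - x) * (1 - m%:R * x))); first nra.
by rewrite ler_wpM2l ?subr_ge0.
Qed.

(** * Asymptotic powers of n *)

Lemma power_order_gt0 (R : realType) (u : nat -> R) (a : R) :
  power_order u a -> (\forall n \near \oo, 0 < u n)%classic.
Proof.
move=> [eps [_ uE]]; near=> n; rewrite (near uE n) //; apply: powR_gt0.
by apply: (@lt_le_trans _ _ 1) => //; near: n; exact: nbhs_infty_ger.
Unshelve. all: by end_near. Qed.

Lemma power_order_le_half (R : realType) (u : nat -> R) (a : R) :
  a < 0 -> power_order u a -> (\forall n \near \oo, u n <= 2^-1)%classic.
Proof.
(* Half of the negative exponent absorbs [eps n]; the other half leaves [n ^ (- c)]. *)
move=> a0 [eps [eps0 uE]]; pose c := - a / 2.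
have c0 : 0 < c by rewrite /c; lra.
near=> n.
have n1 : 1 <= n%:R :> R by near: n; exact: nbhs_infty_ger.
rewrite (near uE n) //; apply: (@le_trans _ _ (n%:R `^ (- c))).
  rewrite ler_powR //; have : eps n <= c by near: n; exact: cvgr_le eps0 _ c0.
  by rewrite /c; lra.
rewrite powRN lef_pV2 ?posrE ?powR_gt0 ?(lt_le_trans _ n1) //.
(* The bound now amounts to [n] being at least the constant [2 ^ (1 / c)]. *)
have -> : 2 = (2 `^ c^-1) `^ c :> R.
  by rewrite -powRrM mulVf ?gt_eqF // powRr1.
apply: ge0_ler_powR; rewrite ?nnegrE ?powR_ge0 ?ler0n ?(ltW c0) //.
by near: n; exact: nbhs_infty_ger.
Unshelve. all: by end_near. Qed.

Lemma power_order_div_exp (R : realType) (u v : nat -> R) (a b : R) (m : nat) :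
  power_order u a -> power_order v b ->
  power_order (fun n => u n / v n ^+ m) (a - m%:R * b).
Proof.
move=> [e [e0 uE]] [f [f0 vE]]; exists (fun n => e n - m%:R * f n); split.
  rewrite -[0](subr0 0) -[in X in _ - X](mulr0 m%:R).
  by apply: cvgB => //; exact: cvgMl_tmp.
near=> n.
have n0 : 0 < n%:R :> R.
  by apply: (@lt_le_trans _ _ 1) => //; near: n; exact: nbhs_infty_ger.
rewrite (near uE n) // (near vE n) // -powR_mulrn ?powR_ge0 // -powRrM -powRN.
rewrite -powRD; last by rewrite (gt_eqF n0) implybT.
by congr (_ `^ _); ring.
Unshelve. all: by end_near. Qed.

Theorem proposition2p8 (R : realType) (d : nat) (delta : R) (s p q : nat -> R)
    (hd : (2 <= d)%N)
    (hdelta : 0 <= delta < 1)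
    (hs01 : forall n : nat, 0 <= s n <= 1)
    (hs : power_order s (- (d%:R - 1) + delta))
    (hpq : forall n : nat, [/\ 0 <= q n, q n <= p n & p n <= 1]) :
  ((p @ \oo --> (0 : R))%classic ->
     risk_asymptotically_trivial d s p q) /\
  (forall beta : R,
     delta <= (d%:R - 1) / (d%:R + 1) ->
     power_order q (-1 + beta) ->
     2 * delta / (d%:R * (d%:R - 1)) + (d%:R - 2) / d%:R < beta ->
     risk_asymptotically_trivial d s p q).
Proof.
have d2 : 2 <= d%:R :> R by rewrite (ler_nat _ 2).
(* The exponent of [s] is negative as [d >= 2] and [delta < 1]. The value one half is chosen to give
   [s <= 1 - s]. *)
have s_half : (\forall n \near \oo, s n <= 2^-1)%classic.
  by apply: power_order_le_half hs; move: hdelta => /andP[_ ?]; lra.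
split=> [p0 | beta _ hq hbeta].
  (* The first-order loss in [(1 - p) ^ 'C(d, 2)], by Bernoulli's inequality. *)
  exists (fun n => 'C(d, 2)%:R * p n); split.
    by rewrite -[0](mulr0 'C(d, 2)%:R); exact: cvgMl_tmp.
  near=> n => Hhat; have [q0 qp p1] := hpq n.
  have sn : s n <= 2^-1 by near: n.
  have /andP[s0 _] := hs01 n.
  apply: (risk_ge (N := fun Psi A => [disjoint A & pairs_in Psi])) => //.
    move=> Psi H; rewrite graph_pmf_sum_avoid.
    by apply: bernoulli_inequality; rewrite p1 (le_trans q0 qp).
  move=> Psi H A dA; have le_pmf := graph_pmf_setU1_avoid H q0 qp p1 dA.
  have g0 := graph_pmf_ge0 H A q0 qp p1.
  apply: (@le_trans _ _ (s n * graph_pmf (p n) (q n) H A)).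
    exact: ler_wpM2l.
  by apply: ler_wpM2r => //; lra.
have bin2E : 'C(d, 2)%:R = d%:R * (d%:R - 1) / 2 :> R.
  have := bin_ffact d 2; rewrite ffactnS ffactn1 => /(congr1 (fun k => k%:R : R)).
  by rewrite !natrM -subn1 natrB ?(ltnW hd) // => <-; field.
have sq_exp : - (d%:R - 1) + delta - 'C(d, 2)%:R * (-1 + beta) < 0.
  rewrite bin2E; have dd : 0 < d%:R * (d%:R - 1) / 2 :> R by nra.
  (* Scaled by ['C(d, 2)], the hypothesis on [beta] matches the goal, since
     [(d - 1)(d - 2) / 2 = 'C(d, 2) - (d - 1)]. *)
  move: hbeta; rewrite -(ltr_pM2l dd).
  have -> : d%:R * (d%:R - 1) / 2 *
      (2 * delta / (d%:R * (d%:R - 1)) + (d%:R - 2) / d%:R) =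
      delta + (d%:R - 1) * (d%:R - 2) / 2 :> R.
    by field; apply/andP; split; rewrite gt_eqF //; lra.
  by lra.
have sq_half := power_order_le_half sq_exp (power_order_div_exp 'C(d, 2) hs hq).
(* No error term: the likelihood bound holds for every graph, so the event [N] has full mass and
   [c = 1]. *)
exists (fun=> 0); split; first exact: cvg_cst.
near=> n => Hhat; have [q0 qp p1] := hpq n.
have sn : s n <= 2^-1 by near: n.
have sqn : s n / q n ^+ 'C(d, 2) <= 2^-1 by near: n.
have qn : 0 < q n by near: n; exact: power_order_gt0 hq.
rewrite subr0; apply: (risk_ge (N := fun _ => xpredT)) => //.
  by move=> Psi H; rewrite bernoulli_subset_sum1.
move=> Psi H A _; have le_pmf := graph_pmf_setU1_le Psi H A q0 qp p1.
have g0 := graph_pmf_ge0 H A q0 qp p1.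
have g1 := graph_pmf_ge0 (Psi |: H)%SET A q0 qp p1.
have qm : 0 < q n ^+ 'C(d, 2) by rewrite exprn_gt0.
rewrite ler_pdivrMr // in sqn.
(* With [m = 'C(d, 2)] and [P1], [P0] the masses with and without [Psi]: [s P1 <= q^m P1 / 2 <= P0 /
   2 <= (1 - s) P0]. *)
apply: (@le_trans _ _ (2^-1 * (q n ^+ 'C(d, 2) *
    graph_pmf (p n) (q n) (Psi |: H)%SET A))).
  by rewrite mulrA ler_wpM2r.
apply: (@le_trans _ _ (2^-1 * graph_pmf (p n) (q n) H A)).
  by rewrite ler_wpM2l ?invr_ge0.
by apply: ler_wpM2r => //; lra.
Unshelve. all: by end_near. Qed.
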